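(* Consider the component-wise partial order $\leq$ on $\mathbb R^d$ (ordering cone $\mathbb R^d_+$). For every time $t\in\{0,\dots,T-1\}$ and every state $S_t$ we have $$\Big\{\operatorname{v-sup}^t_{\theta\in\Theta}\mathbb E^\theta_t[X]\ :\ \varphi_t\in\mathfrak A_t(S_t),\ X\in\mathcal P_{t+1}(F(t,S_t,\varphi_t,Z_{t+1}))\Big\}\subseteq\mathcal P_t(S_t).$$ If, additionally, the set of models $\Theta$ is $m$-rectangular, then for every time $t\in\{0,\dots,T-1\}$ and every state $S_t$ $$\mathcal P_t(S_t)=\operatorname{cl}\Big\{\operatorname{v-sup}^t_{\theta\in\Theta}\mathbb E^\theta_t[X]\ :\ \varphi_t\in\mathfrak A_t(S_t),\ X\in\mathcal P_{t+1}(F(t,S_t,\varphi_t,Z_{t+1}))\Big\}.$$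
   Context: Probabilistic setting. $(\Omega,\mathscr F)$ is a measurable space, $T\in\mathbb N$, $(\mathscr F_t)_{t=0,\dots,T}$ is the observation filtration, $\Theta\subset\mathbb R^d$ is a non-empty finite set, and $\{\mathbb Q_\theta:\theta\in\Theta\}$ is a family of probability measures on $(\Omega,\mathscr F)$, absolutely continuous with respect to a reference probability measure $\mathbb P$. $\mathbb E^\theta_t$ is the conditional expectation under $\mathbb Q_\theta$ given $\mathscr F_t$. All equalities, inequalities and inclusions are in the $\mathbb P$-a.s. sense. $\mathscr L_t(\mathbb R^d):=L^1(\Omega,\mathscr F_t,\mathbb P;\mathbb R^d)$. Conditional expectations $\mathbb E^\theta_t[X]$, $X$ integrable and $\mathscr F_s$-measurable, $s\ge t$, are understood to be well-defined elements of $\mathscr L_t(\mathbb R^d)$ (resp. $\mathscr L_t(\mathbb R)$), determined up to $\mathbb P$-null sets. Order and supremum. $\mathscr L_t(\mathbb R^d_+)$ is the set of elements of $\mathscr L_t(\mathbb R^d)$ with values in $\mathbb R^d_+$; $X\leq^tY$ iff $Y-X\in\mathscr L_t(\mathbb R^d_+)$. $\operatorname{v-sup}^t_{\theta\in\Theta}X^\theta$ is the supremum of $\{X^\theta\}_{\theta\in\Theta}\subseteq\mathscr L_t(\mathbb R^d)$ with respect to $\leq^t$, i.e. the ($\mathbb P$-a.s. unique) $V\in\mathscr L_t(\mathbb R^d)$ such that $X^\theta\leq^tV$ for all $\theta$, and $V\leq^tA$ whenever $A\in\mathscr L_t(\mathbb R^d)$ satisfies $X^\theta\leq^tA$ for all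 $\theta$; it is the component-wise maximum. $m$-rectangularity. $\Theta$ is $m$-rectangular if for all $t=0,\dots,T-1$ and all $X\in\mathscr L_T(\mathbb R)$, $$\sup_{\theta\in\Theta}\mathbb E^\theta_t\Big[\sup_{\theta'\in\Theta}\mathbb E^{\theta'}_{t+1}[X]\Big]=\sup_{\theta\in\Theta}\mathbb E^\theta_t[X].$$ Control setting. $S_{t+1}=F(t,S_t,\varphi_t,Z_{t+1})$, $t=0,\dots,T-1$, $S_0=s$, where $S$ takes values in a measurable space $\mathbb S\subset\mathbb R^m$, $Z$ is an $\mathbb R^k$-valued random sequence, the controls $\varphi_t$ take values in a compact set $A$, and $F$ is measurable. Given the state $S_t$ at time $t$, $\mathfrak A_t(S_t)$ is the set of admissible one-step controls $\varphi_t$ and $\mathfrak A^t(S_t)$ is the set of admissible controls $\varphi=(\varphi_t,\dots,\varphi_{T-1})$ starting at time $t$; one has $(\varphi_t,\tilde\varphi)\in\mathfrak A^t(S_t)$ iff $\varphi_t\in\mathfrak A_t(S_t)$ and $\tilde\varphi\in\mathfrak A^{t+1}(F(t,S_t,\varphi_t,Z_{t+1}))$. $S^\varphi_T$ is the terminal state generated from $S_t$ by $\varphi$, and states $S_t$ are $\mathscr F_t$-measurable. $\ell:\mathbb S\to\mathbb R^d$ is a loss function, with $\ell(S^\varphi_T)\in\mathscr L_T(\mathbb R^d)$ for admissible $\varphi$. Value function and upper image. $\mathcal V_T(S_T)=\{\ell(S_T)\}$ and, for $t=0,\dots,T-1$, $$\mathcal V_t(S_t)=\Big\{\operatorname{v-sup}^t_{\theta\in\Theta}\mathbb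 E^\theta_t[\ell(S^\varphi_T)]:\varphi\in\mathfrak A^t(S_t)\Big\}.$$ The upper image is $\mathcal P_t(S_t)=\operatorname{cl}\big(\mathcal V_t(S_t)+\mathscr L_t(\mathbb R^d_+)\big)$, $t=0,\dots,T$. The closure $\operatorname{cl}$ is taken in $\mathscr L_t(\mathbb R^d)$ with respect to its norm topology, the norm on $\mathscr L_t(\mathbb R^d)$ being $X\mapsto\mathbb E_{\mathbb P}[|X|]$ with $|\cdot|$ the Euclidean norm on $\mathbb R^d$. *)

(* Defs.v *)
From HB Require Import structures.
From mathcomp Require Import all_boot all_order all_algebra.
From mathcomp Require Import all_classical all_reals all_analysis.

Set Implicit Arguments.
Unset Strict Implicit.
Unset Printing Implicit Defensive.

Import Order.TTheory GRing.Theory Num.Theory.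
Import numFieldNormedType.Exports.

Local Open Scope classical_set_scope.
Local Open Scope ring_scope.

(* Conventions.
   - An element of L^1(Omega, G, P) is represented by its G-measurable
     integrable representatives; a subset of L^1 is represented by the set of
     all representatives of its elements, so that inclusion and equality of
     these sets of functions are inclusion and equality up to P-null sets.
   - R^n is 'rV[R]_n; a map into R^n is measurable or integrable when its
     coordinates are. The norm of 'rV[R]_n in the library is the sup norm, hence
     enorm below. *)

Section Preliminaries.
Context {R : realType} {disp : measure_display} {Omega : measurableType disp}.
Implicit Types G : set_system Omega.

Definition enorm n (x : 'rV[R]_n) : R := Num.sqrt (\sum_(i < n) x 0 i ^+ 2).

Definition coord n (X : Omega -> 'rV[R]_n) (i : 'I_n) : Omega -> R :=
  fun w => X w 0 i.

Definition G_measurable G (X : Omega -> R) : Prop :=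
  preimage_set_system setT X measurable `<=` G.

Definition G_measurable_vec G n (X : Omega -> 'rV[R]_n) : Prop :=
  forall i, G_measurable G (coord X i).

Definition L1 (mu : probability Omega R) G : set (Omega -> R) :=
  [set X | G_measurable G X /\ mu.-integrable setT (EFin \o X)].

Definition L1vec (mu : probability Omega R) G n : set (Omega -> 'rV[R]_n) :=
  [set X | forall i, L1 mu G (coord X i)].

Definition is_cond_exp (mu : probability Omega R) G (X Y : Omega -> R) : Prop :=
  [/\ mu.-integrable setT (EFin \o X),
      G_measurable G Y,
      mu.-integrable setT (EFin \o Y) &
      forall B, G B ->
        (\int[mu]_(w in B) (Y w)%:E = \int[mu]_(w in B) (X w)%:E)%E].

Definition cond_exp (mu : probability Omega R) G (X : Omega -> R) :
    Omega -> R :=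
  xget (cst 0) [set Y | is_cond_exp mu G X Y].

Definition cond_exp_vec (mu : probability Omega R) G n
    (X : Omega -> 'rV[R]_n) : Omega -> 'rV[R]_n :=
  fun w => \row_i cond_exp mu G (coord X i) w.

Definition borel (X : topologicalType) : set_system X := <<s @open X >>.

Definition borel_prod3 (X Y Z : topologicalType) : set_system (X * Y * Z) :=
  <<s [set B | exists B1 B2 B3, [/\ borel B1, borel B2, borel B3 &
                                    B = B1 `*` B2 `*` B3]] >>.

End Preliminaries.

Record model (R : realType) (disp : measure_display)
    (Omega : measurableType disp) (U : topologicalType) (d m k : nat) := Model {
  hor : nat;                                       (* T *)
  fil : nat -> set_system Omega;                   (* F_t *)
  ref : probability Omega R;                       (* P *)
  Theta : set 'rV[R]_d;
  Q : 'rV[R]_d -> probability Omega R;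
  St_space : set 'rV[R]_m;                         (* the state space in R^m *)
  Ctl_space : set U;                               (* A *)
  trans : nat -> 'rV[R]_m -> U -> 'rV[R]_k -> 'rV[R]_m;   (* F(t,.,.,.) *)
  noise : nat -> Omega -> 'rV[R]_k;                (* Z_t *)
  s0 : 'rV[R]_m;                                   (* the initial state s *)
  state : nat -> set (Omega -> 'rV[R]_m);          (* the states S_t at time t *)
  (* one-step admissible controls at time t, given the state S_t *)
  adm1 : nat -> (Omega -> 'rV[R]_m) -> set (Omega -> U);
  loss : 'rV[R]_m -> 'rV[R]_d }.

Section ModelDefs.
Context {R : realType} {disp : measure_display} {Omega : measurableType disp}.
Context {U : topologicalType} {d m k : nat}.
Variable M : model R Omega U d m k.

Local Notation T := (hor M).
Local Notation P := (ref M).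

Definition Lt (t : nat) : set (Omega -> R) := L1 P (fil M t).

Definition Ltd (t : nat) : set (Omega -> 'rV[R]_d) := @L1vec _ _ _ P (fil M t) d.

Definition Ltd_pos (t : nat) : set (Omega -> 'rV[R]_d) :=
  [set X | Ltd t X /\ {ae P, forall w, forall i, 0 <= X w 0 i}].

Definition le_Lt (t : nat) (X Y : Omega -> 'rV[R]_d) : Prop :=
  Ltd_pos t (fun w => Y w - X w).

Definition Eth (theta : 'rV[R]_d) (t : nat) (X : Omega -> R) : Omega -> R :=
  cond_exp (Q M theta) (fil M t) X.

Definition Ethd (theta : 'rV[R]_d) (t : nat) (X : Omega -> 'rV[R]_d) :
    Omega -> 'rV[R]_d :=
  cond_exp_vec (Q M theta) (fil M t) X.

(* V is (a representative of) v-sup^t_{theta in Theta} X^theta *)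
Definition is_vsup (t : nat) (X : 'rV[R]_d -> Omega -> 'rV[R]_d)
    (V : Omega -> 'rV[R]_d) : Prop :=
  [/\ Ltd t V,
      forall theta, Theta M theta -> le_Lt t (X theta) V &
      forall A, Ltd t A ->
        (forall theta, Theta M theta -> le_Lt t (X theta) A) -> le_Lt t V A].

Definition sup_Eth (t : nat) (X : Omega -> R) : Omega -> R :=
  fun w => sup [set Eth theta t X w | theta in Theta M].

Definition m_rectangular : Prop :=
  forall t X, (t < T)%N -> Lt T X ->
    {ae P, forall w, sup_Eth t (sup_Eth t.+1 X) w = sup_Eth t X w}.

(* F(t, S_t, phi_t, Z_{t+1}) *)
Definition next_state (t : nat) (S : Omega -> 'rV[R]_m) (c : Omega -> U) :
    Omega -> 'rV[R]_m :=
  fun w => trans M t (S w) (c w) (noise M t.+1 w).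

(* A control (phi_t, ..., phi_{T-1}) is the list of its components; the only
   control starting at time T is the empty one. *)
Fixpoint adm (t : nat) (S : Omega -> 'rV[R]_m) (phi : seq (Omega -> U)) : Prop :=
  match phi with
  | [::] => t = T
  | c :: phi' => [/\ (t < T)%N, adm1 M t S c & adm t.+1 (next_state t S c) phi']
  end.

Fixpoint terminal (t : nat) (S : Omega -> 'rV[R]_m) (phi : seq (Omega -> U)) :
    Omega -> 'rV[R]_m :=
  match phi with
  | [::] => S
  | c :: phi' => terminal t.+1 (next_state t S c) phi'
  end.

Definition terminal_loss (t : nat) (S : Omega -> 'rV[R]_m)
    (phi : seq (Omega -> U)) : Omega -> 'rV[R]_d :=
  fun w => loss M (terminal t S phi w).

Definition value (t : nat) (S : Omega -> 'rV[R]_m) : set (Omega -> 'rV[R]_d) :=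
  if (t < T)%N then
    [set V | exists2 phi, adm t S phi &
       is_vsup t (fun theta => Ethd theta t (terminal_loss t S phi)) V]
  else [set V | Ltd T V /\ {ae P, forall w, V w = loss M (S w)}].

Definition closure_L1 (t : nat) (B : set (Omega -> 'rV[R]_d)) :
    set (Omega -> 'rV[R]_d) :=
  [set X | Ltd t X /\ forall e : R, 0 < e -> exists2 Y, B Y /\ Ltd t Y &
             (\int[P]_w (enorm (X w - Y w))%:E < e%:E)%E].

Definition upper_image (t : nat) (S : Omega -> 'rV[R]_m) :
    set (Omega -> 'rV[R]_d) :=
  closure_L1 t [set (fun w => V w + W w) | V in value t S & W in Ltd_pos t].

Definition one_step (t : nat) (S : Omega -> 'rV[R]_m) :
    set (Omega -> 'rV[R]_d) :=
  [set V | exists c X, [/\ adm1 M t S c,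
                           upper_image t.+1 (next_state t S c) X &
                           is_vsup t (fun theta => Ethd theta t X) V]].

Record standing_assumptions : Prop := {
  fil_sigma : forall t, (t <= T)%N -> sigma_algebra setT (fil M t);
  fil_sub : forall t, (t <= T)%N -> fil M t `<=` measurable;
  fil_mono : forall r t, (r <= t)%N -> (t <= T)%N -> fil M r `<=` fil M t;
  Theta_nonempty : Theta M !=set0;
  Theta_finite : finite_set (Theta M);
  Q_dominated : forall theta, Theta M theta -> Q M theta `<< P;
  (* E^theta_t[X] is a well-defined element of L_t(R), unique P-a.s. (and not
     merely Q_theta-a.s.) *)
  Eth_exists : forall theta t r X, Theta M theta ->
    (t <= r)%N -> (r <= T)%N -> Lt r X ->
    exists2 Y, Lt t Y & is_cond_exp (Q M theta) (fil M t) X Y;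
  Eth_unique : forall theta t r X Y Y', Theta M theta ->
    (t <= r)%N -> (r <= T)%N -> Lt r X ->
    is_cond_exp (Q M theta) (fil M t) X Y ->
    is_cond_exp (Q M theta) (fil M t) X Y' ->
    {ae P, forall w, Y w = Y' w};
  Ctl_compact : compact (Ctl_space M);
  noise_measurable : forall t, (0 < t <= T)%N ->
    G_measurable_vec measurable (noise M t);
  trans_space : forall t x a z, (t < T)%N -> St_space M x -> Ctl_space M a ->
    St_space M (trans M t x a z);
  (* trans t is measurable on St_space * Ctl_space * R^k, equipped with the
     trace of the product sigma-algebra *)
  trans_measurable : forall t B, (t < T)%N -> borel B ->
    exists2 C, borel_prod3 C &
      forall x a z, St_space M x -> Ctl_space M a ->
        (B (trans M t x a z) <-> C (x, a, z));
  s0_space : St_space M (s0 M);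
  (* "state t" may be any class of random states with the properties below: for
     example those reachable from s0 by admissible controls, or all random
     states from which admissible controls have an integrable terminal loss. *)
  state_init : state M 0 (cst (s0 M));
  state_next : forall t S c, (t < T)%N -> state M t S -> adm1 M t S c ->
    state M t.+1 (next_state t S c);
  state_space : forall t S w, (t <= T)%N -> state M t S -> St_space M (S w);
  state_measurable : forall t S, (t <= T)%N -> state M t S ->
    G_measurable_vec (fil M t) S;
  adm1_space : forall t S c w, (t < T)%N -> state M t S -> adm1 M t S c ->
    Ctl_space M (c w);
  loss_integrable : forall t S phi, (t <= T)%N -> state M t S -> adm t S phi ->
    Ltd T (terminal_loss t S phi) }.

End ModelDefs.

(* Main.v *)
Require Import Defs.
From HB Require Import structures.
From mathcomp Require Import all_boot all_order all_algebra.
From mathcomp Require Import all_classical all_reals all_analysis.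
From mathcomp Require Import measurable_realfun lra.

(** Write E_theta,t for the conditional expectation under Q_theta given F_t and
    rho_t(X) for the componentwise maximum over theta of E_theta,t[X].  Since
    Theta is finite, the supremum in the statement exists and equals rho_t(X)
    almost surely ([is_vsupP]), and the proposition becomes a statement about
    the monotone operators rho_t on L^1.

    Inclusion.  Let X belong to the upper image at t+1.  It is an L^1-limit of
    random vectors Y = V' + W with V' in the value set at t+1 and W >= 0.
    Such a V' dominates E_theta,t+1 of some terminal loss for every theta, so by
    the tower property and monotonicity rho_t(Y) dominates rho_t of this loss,
    which is an element of the value set at t; hence rho_t(Y) lies in the value
    set plus the cone ([value_pos_of_ge]).  It remains to let Y tend to X, which
    needs continuity of rho_t in L^1(P).

    Continuity.  The densities dQ_theta/dP need not be bounded, so continuity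
    is not immediate.  It follows from the standing assumption that E_theta,t
    maps L^1(P) into L^1(P): a positive additive operator between L^1 spaces is
    automatically continuous ([positive_continuous]).  Positivity and additivity
    must hold P-almost surely and not only Q_theta-almost surely; the
    P-uniqueness of versions provides this.  The difference of two values of
    rho_t is bounded by the sum over theta of E_theta,t[|X - Y|]
    ([sup_Eth_continuous]).

    Equality.  An upper image is closed, so the inclusion passes to the closure
    of the left-hand side.  Conversely, an element of the value set at t plus
    the cone is rho_t(l) + W for a terminal loss l of a control (c, phi).  By
    rectangularity rho_t(l) = rho_t(rho_t+1(l)), and as W is F_t-measurable it
    enters rho_t additively, so the element equals rho_t(rho_t+1(l) + W), where
    rho_t+1(l) + W lies in the upper image at t+1 reached by c
    ([value_pos_sub_one_step]). *)

Local Open Scope classical_set_scope.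

Set Implicit Arguments.
Unset Strict Implicit.
Unset Printing Implicit Defensive.

Import Order.TTheory GRing.Theory Num.Theory.
Import numFieldNormedType.Exports.

Local Open Scope ring_scope.

(** * Suprema of finite families of reals *)

Section FiniteSup.
Context {R : realType} {I : choiceType} (A : set I).
Hypotheses (A0 : A !=set0) (Afin : finite_set A).
Implicit Types (f g : I -> R).

Lemma finite_sup_ub f i : A i -> f i <= sup [set f j | j in A].
Proof.
move=> Ai; apply: ub_le_sup; last by exists i.
have /finite_seqP[s As] := Afin; exists (\sum_(j <- s) `|f j|) => _ [j Aj <-].
have js : j \in s by rewrite As in Aj.
rewrite (perm_big _ (perm_to_rem js)) big_cons /=.
apply: (le_trans (ler_norm _)); rewrite lerDl; exact: sumr_ge0.
Qed.

Lemma finite_sup_le f x : (forall i, A i -> f i <= x) ->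
  sup [set f j | j in A] <= x.
Proof.
move=> fx; apply: ge_sup; first by case: A0 => i Ai; exists (f i), i.
by move=> _ [i Ai <-]; exact: fx.
Qed.

Lemma finite_sup_dist f g e : (forall i, A i -> `|f i - g i| <= e) ->
  `|sup [set f j | j in A] - sup [set g j | j in A]| <= e.
Proof.
move=> fge; rewrite ler_norml; apply/andP; split.
  rewrite lerBrDr addrC lerBlDr; apply: finite_sup_le => i Ai.
  have := finite_sup_ub f Ai; have := fge _ Ai; rewrite ler_norml; lra.
rewrite lerBlDr; apply: finite_sup_le => i Ai.
have := finite_sup_ub g Ai; have := fge _ Ai; rewrite ler_norml; lra.
Qed.

End FiniteSup.

(** * Integrable functions measurable for a sub-sigma-algebra *)

Section L1.
Context {R : realType} {disp : measure_display} {Omega : measurableType disp}.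
Variables (mu : probability Omega R) (G : set_system Omega).
Hypotheses (sG : sigma_algebra setT G) (Gm : G `<=` measurable).
Implicit Types X Y : Omega -> R.

(** Transfers the closure properties of measurable functions to a
    sub-sigma-algebra, viewed as the measurable structure it generates. *)
Lemma G_measurableP X :
  G_measurable G X <-> measurable_fun [set: g_sigma_algebraType G] X.
Proof.
rewrite /G_measurable /preimage_set_system; split.
  move=> mX _ B mB; rewrite measurable_g_measurableTypeE//.
  by apply: mX; exists B.
move=> mX _ [B mB <-].
by have := mX measurableT B mB; rewrite measurable_g_measurableTypeE.
Qed.

Lemma G_measurable_fun X : G_measurable G X -> measurable_fun setT X.
Proof. by move=> mX _ B mB; apply: Gm; apply: mX; exists B. Qed.

Lemma L1_integrable X : L1 mu G X -> mu.-integrable setT (EFin \o X).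
Proof. by case. Qed.

Lemma L1_measurable X : L1 mu G X -> measurable_fun setT (EFin \o X).
Proof. by case=> mX _; apply/measurable_EFinP; exact: G_measurable_fun. Qed.

Lemma L1_dominated X Y : G_measurable G X -> (forall w, `|X w| <= `|Y w|) ->
  L1 mu G Y -> L1 mu G X.
Proof.
move=> mX XY [mY iY]; split=> //; apply: le_integrable iY => //.
  by apply/measurable_EFinP; exact: G_measurable_fun.
by move=> w _; rewrite lee_fin.
Qed.

(** Measurability of [Y] has to be assumed: the sub-sigma-algebra need not
    contain the null sets. *)
Lemma L1_ae_eq X Y : G_measurable G Y -> {ae mu, forall w, X w = Y w} ->
  L1 mu G X -> L1 mu G Y.
Proof.
move=> mY XY LX; split=> //.
have mX := L1_measurable LX.
have mYE : measurable_fun setT (EFin \o Y).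
  by apply/measurable_EFinP; exact: G_measurable_fun.
have /integrableP[_ fX] := L1_integrable LX.
apply/integrableP; split=> //; apply: le_lt_trans fX.
apply: ae_ge0_le_integral => //.
- exact: measurableT_comp.
- exact: measurableT_comp.
- by apply: filterS XY => w /= -> _.
Qed.

Lemma L1_cst c : L1 mu G (cst c).
Proof.
split; first by apply/G_measurableP; exact: measurable_cst.
exact: finite_measure_integrable_cst.
Qed.

Lemma L1D X Y : L1 mu G X -> L1 mu G Y -> L1 mu G (fun w => X w + Y w).
Proof.
move=> [mX iX] [mY iY]; split; last exact: integrableD iX iY.
by apply/G_measurableP; apply: measurable_funD; exact/G_measurableP.
Qed.

Lemma L1N X : L1 mu G X -> L1 mu G (fun w => - X w).
Proof.
move=> [mX iX]; split; last exact: integrableN iX.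
by apply/G_measurableP; apply: measurableT_comp => //; exact/G_measurableP.
Qed.

Lemma L1B X Y : L1 mu G X -> L1 mu G Y -> L1 mu G (fun w => X w - Y w).
Proof. by move=> LX LY; apply: L1D => //; exact: L1N. Qed.

Lemma L1_norm X : L1 mu G X -> L1 mu G (fun w => `|X w|).
Proof.
move=> LX; apply: L1_dominated (LX) => [|w]; last by rewrite normr_id.
by apply/G_measurableP; apply: measurableT_comp => //; apply/G_measurableP; case: LX.
Qed.

Lemma L1_max X Y : L1 mu G X -> L1 mu G Y ->
  L1 mu G (fun w => Num.max (X w) (Y w)).
Proof.
move=> LX LY.
apply: (@L1_dominated _ (fun w => `|X w| + `|Y w|)).
- by apply/G_measurableP; apply: measurable_maxr;
    apply/G_measurableP; [case: LX|case: LY].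
- move=> w; rewrite (ger0_norm (addr_ge0 _ _))//.
  by case: (leP (X w) (Y w)) => _; rewrite ?lerDl ?lerDr.
- by apply: L1D; exact: L1_norm.
Qed.

Lemma L1_sum (I : eqType) (s : seq I) (f : I -> Omega -> R) :
  (forall i, i \in s -> L1 mu G (f i)) ->
  L1 mu G (fun w => \sum_(i <- s) f i w).
Proof.
elim: s => [|i s IH] Lf; first by under eq_fun do rewrite big_nil; exact: L1_cst.
under eq_fun do rewrite big_cons; apply: L1D; first by apply: Lf; exact: mem_head.
by apply: IH => j js; apply: Lf; rewrite in_cons js orbT.
Qed.

Lemma L1_finite_sup (I : choiceType) (A : set I) (f : I -> Omega -> R) :
  A !=set0 -> finite_set A -> (forall i, A i -> L1 mu G (f i)) ->
  L1 mu G (fun w => sup [set f i w | i in A]).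
Proof.
move=> A0 Afin Lf; have /finite_seqP[s As] := Afin; have [i0 Ai0] := A0.
have -> : (fun w => sup [set f i w | i in A]) =
          (fun w => \big[Num.max/f i0 w]_(i <- s) f i w).
  apply/funext => w; apply/eqP; rewrite eq_le; apply/andP; split.
    apply: finite_sup_le => // i; rewrite As /= => si.
    by apply: le_bigmax_seq.
  rewrite big_seq; elim/big_ind: _ => [|x y ? ?|i si].
  - exact: (finite_sup_ub _ (fun i => f i w)).
  - by rewrite ge_max; apply/andP.
  - by apply: (finite_sup_ub _ (fun i => f i w)) => //; rewrite As.
have {As A0 Afin} : forall i, i \in s -> L1 mu G (f i).
  by move=> i si; apply: Lf; rewrite As.
elim: s => [|i s IH] Ls.
  by under eq_fun do rewrite big_nil; exact: Lf.
under eq_fun do rewrite big_cons; apply: L1_max.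
  by apply: Ls; rewrite mem_head.
by apply: IH => j js; apply: Ls; rewrite in_cons js orbT.
Qed.

Lemma L1_integral X : L1 mu G X -> (\int[mu]_w (X w)%:E)%E \is a fin_num.
Proof. by case=> _; exact: integrable_fin_num. Qed.

Lemma ae_le_integral X Y : L1 mu G X -> L1 mu G Y ->
  {ae mu, forall w, X w <= Y w} ->
  (\int[mu]_w (X w)%:E <= \int[mu]_w (Y w)%:E)%E.
Proof.
move=> LX LY XY.
(* [D] equals [Y - X] almost everywhere and is nonnegative everywhere. *)
pose D w : R := `|Y w - X w|; have LD : L1 mu G D by apply: L1_norm; exact: L1B.
rewrite [leRHS](@ae_eq_integral _ _ _ mu setT (fun w => (X w)%:E + (D w)%:E)%E) => //.
- rewrite (integralD measurableT (L1_integrable LX) (L1_integrable LD)).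
  by rewrite leeDl// integral_ge0// => w _; rewrite lee_fin /D normr_ge0.
- exact: L1_measurable LY.
- by apply: emeasurable_funD; [exact: L1_measurable LX|exact: L1_measurable LD].
- apply: filterS XY => w XY _; rewrite -EFinD /D ger0_norm ?subr_ge0//.
  by rewrite addrC subrK.
Qed.

End L1.

(** * Automatic continuity of positive operators on L^1 *)

Section AutomaticContinuity.
Context {R : realType} {disp : measure_display} {Omega : measurableType disp}.
Variables (mu : probability Omega R) (G H : set_system Omega).
Hypotheses (sG : sigma_algebra setT G) (Gm : G `<=` measurable).
Hypotheses (sH : sigma_algebra setT H) (Hm : H `<=` measurable).
Variable E : (Omega -> R) -> (Omega -> R).
Hypothesis E_L1 : forall X, L1 mu G X -> L1 mu H (E X).
Hypothesis E_add : forall X Y, L1 mu G X -> L1 mu G Y ->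
  {ae mu, forall w, E (fun v => X v + Y v) w = E X w + E Y w}.
Hypothesis E_ge0 : forall X, L1 mu G X ->
  {ae mu, forall w, 0 <= X w} -> {ae mu, forall w, 0 <= E X w}.

Lemma positive_le X Y : L1 mu G X -> L1 mu G Y ->
  {ae mu, forall w, X w <= Y w} -> {ae mu, forall w, E X w <= E Y w}.
Proof.
move=> LX LY XY; have LYX := L1B sG LY LX.
have ge0 : {ae mu, forall w, 0 <= E (fun v => Y v - X v) w}.
  by apply: E_ge0 => //; apply: filterS XY => w; rewrite subr_ge0.
have add := E_add LYX LX; apply: filterS2 ge0 add => w.
rewrite (_ : (fun v => Y v - X v + X v) = Y).
  by move=> ge0 ->; rewrite lerDr.
by apply/funext => v; rewrite subrK.
Qed.

(** The sum of the series may be infinite on a null set, where [fine] replaces it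
    by 0; this is why the partial sums are bounded only almost everywhere. *)
Lemma series_L1 (X : nat -> Omega -> R) :
  (forall n, L1 mu G (X n)) -> (forall n w, 0 <= X n w) ->
  (\sum_(n <oo) \int[mu]_w (X n w)%:E < +oo)%E ->
  exists2 Z, L1 mu G Z &
    forall N, {ae mu, forall w, \sum_(n < N) X n w <= Z w}.
Proof.
move=> LX X0 fin.
pose S w := (\sum_(n <oo) (X n w)%:E)%E; pose Z w : R := fine (S w).
have X0E n w : (0 <= (X n w)%:E)%E by rewrite lee_fin.
have S0 w : (0 <= S w)%E by apply: nneseries_ge0 => n _ _.
have mZ : G_measurable G Z.
  apply/(G_measurableP sG); apply: measurableT_comp => //.
  apply: ge0_emeasurable_sum => // n _; apply/measurable_EFinP.
  by apply/(G_measurableP sG); case: (LX n).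
have mS : measurable_fun [set: Omega] S.
  by apply: ge0_emeasurable_sum => // n _; exact: (L1_measurable Gm (LX n)).
have iS : mu.-integrable setT S.
  apply/integrableP; split=> //; under eq_integral do rewrite gee0_abs//.
  rewrite integral_nneseries// => n; exact: (L1_measurable Gm (LX n)).
have fS : {ae mu, forall w, S w \is a fin_num}.
  by apply: filterS (integrable_ae measurableT iS) => w /(_ I).
have LZ : L1 mu G Z.
  split=> //; apply: le_integrable iS => // [|w _].
    by apply/measurable_EFinP; exact: (G_measurable_fun Gm).
  by rewrite /= /Z; case: (S w) => //=; rewrite leey.
exists Z => // N; apply: filterS fS => w fSw.
rewrite -lee_fin /Z fineK// -sumEFin.
rewrite -(big_mkord xpredT (fun n => (X n w)%:E)).
exact: nneseries_lim_ge.
Qed.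

(** If continuity at 0 failed, there would be nonnegative X_n with integral at
    most 2^-(n+1) whose images all have integral at least e.  The sum Z of the
    X_n is integrable and dominates every partial sum, so by positivity and
    additivity E Z has integral at least N * e for every N, whereas E Z is
    integrable. *)
Theorem positive_continuous e : 0 < e -> exists2 dl, 0 < dl &
  forall X, L1 mu G X -> (forall w, 0 <= X w) ->
    (\int[mu]_w (X w)%:E < dl%:E)%E -> (\int[mu]_w (E X w)%:E < e%:E)%E.
Proof.
move=> e0; apply: contrapT => nodl.
have bad n : exists X, [/\ L1 mu G X, forall w, 0 <= X w,
    (\int[mu]_w (X w)%:E <= (1 / (2 ^ n.+1)%:R)%:E)%E &
    (e%:E <= \int[mu]_w (E X w)%:E)%E].
  apply: contrapT => noX; apply: nodl.
  exists (1 / (2 ^ n.+1)%:R) => [|X LX X0 sX].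
    by rewrite divr_gt0// ltr0n expn_gt0.
  by rewrite ltNge; apply/negP => bX; apply: noX; exists X; split=> //; exact: ltW.
have [X HX] := choice bad.
have LX n : L1 mu G (X n) by case: (HX n).
have X0 n w : 0 <= X n w by case: (HX n).
have [Z LZ XZ] : exists2 Z, L1 mu G Z &
    forall N, {ae mu, forall w, \sum_(n < N) X n w <= Z w}.
  apply: series_L1 => //; apply: (@le_lt_trans _ _ 1%:E); last exact: ltry.
  apply: le_trans (epsilon_trick0 xpredT ler01).
  apply: lee_nneseries => [n _ _|n _]; last by case: (HX n).
  by apply: integral_ge0 => w _; rewrite lee_fin.
pose S N w : R := \sum_(n < N) X n w.
have LS N : L1 mu G (S N) by apply: (L1_sum sG) => n _.
have ES N : ((N%:R * e)%:E <= \int[mu]_w (E (S N) w)%:E)%E.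
  elim: N => [|N IH].
    rewrite mul0r.
    have -> : 0%:E = (\int[mu]_w (cst (0 : R) w)%:E)%E by rewrite integral0.
    apply: (ae_le_integral sH Hm); [exact: (L1_cst mu sH)|exact: E_L1|].
    apply: E_ge0 => //; apply: filterS (XZ 0) => w _.
    by rewrite /S big_ord0.
  have SN1 : S N.+1 = fun v => S N v + X N v.
    by apply/funext => v; rewrite /S big_ord_recr.
  have LES := E_L1 (LS N); have LEX := E_L1 (LX N).
  apply: (@le_trans _ _ (\int[mu]_w (E (S N) w + E (X N) w)%:E)%E).
    under eq_integral do rewrite EFinD.
    rewrite (integralD measurableT (L1_integrable LES) (L1_integrable LEX)).
    rewrite -natr1 mulrDl mul1r EFinD; apply: leeD => //.
    by case: (HX N).
  apply: (ae_le_integral sH Hm); [exact: (L1D sH)|exact: E_L1|].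
  by rewrite SN1; apply: filterS (E_add (LS N) (LX N)) => w ->.
have LEZ := E_L1 LZ; have fEZ := L1_integral LEZ.
set c := fine (\int[mu]_w (E Z w)%:E).
have Nec N : N%:R * e <= c.
  rewrite -lee_fin fineK//; apply: le_trans (ES N) _.
  apply: (ae_le_integral sH Hm); [exact: E_L1|exact: E_L1|].
  exact: (positive_le (LS N) LZ (XZ N)).
have := Nec (Num.truncn (c / e)).+1; rewrite leNgt => /negP; apply.
by rewrite -ltr_pdivrMr// truncnS_gt.
Qed.

End AutomaticContinuity.

(** * Versions of a conditional expectation *)

Section CondExp.
Context {R : realType} {disp : measure_display} {Omega : measurableType disp}.
Variables (mu : probability Omega R) (G : set_system Omega).
Hypotheses (sG : sigma_algebra setT G) (Gm : G `<=` measurable).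
Implicit Types X Y : Omega -> R.

Lemma is_cond_exp_self X : L1 mu G X -> is_cond_exp mu G X X.
Proof. by case. Qed.

Lemma is_cond_expD X1 X2 Y1 Y2 :
  is_cond_exp mu G X1 Y1 -> is_cond_exp mu G X2 Y2 ->
  is_cond_exp mu G (fun w => X1 w + X2 w) (fun w => Y1 w + Y2 w).
Proof.
move=> [iX1 mY1 iY1 e1] [iX2 mY2 iY2 e2].
have LY : L1 mu G (fun w => Y1 w + Y2 w) by exact: L1D.
split=> [||//|B GB]; [exact: integrableD iX1 iX2|by case: LY|by case: LY|].
have mB := Gm GB.
have iB (X : Omega -> R) : mu.-integrable setT (EFin \o X) ->
  mu.-integrable B (EFin \o X) by exact: integrableS.
under eq_integral do rewrite EFinD.
under [RHS]eq_integral do rewrite EFinD.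
rewrite (integralD mB (iB _ iY1) (iB _ iY2)) (integralD mB (iB _ iX1) (iB _ iX2)).
by rewrite /= e1// e2.
Qed.

Lemma is_cond_exp_tower (G' : set_system Omega) X Y Z : G `<=` G' ->
  is_cond_exp mu G' X Y -> is_cond_exp mu G Y Z -> is_cond_exp mu G X Z.
Proof.
move=> GG' [iX _ _ eXY] [_ mZ iZ eYZ]; split=> // B GB.
by rewrite eYZ// eXY//; exact: GG'.
Qed.

Lemma is_cond_exp_ae_eq X Y Y' : L1 mu G Y' ->
  {ae mu, forall w, Y w = Y' w} -> is_cond_exp mu G X Y -> is_cond_exp mu G X Y'.
Proof.
move=> LY' YY' [iX mY iY eXY]; have [mY' iY'] := LY'.
split=> // B GB; rewrite -eXY//; apply: ae_eq_integral.
- exact: Gm.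
- by apply: measurable_funTS; exact: L1_measurable LY'.
- by apply: measurable_funTS; apply: (L1_measurable Gm (mu := mu)); split.
- by apply: filterS YY' => w /= ->.
Qed.

(** On the event N where the version Y is negative, the integral of Y equals that
    of X, hence is nonnegative; so Y vanishes almost everywhere on N and N is
    null. *)
Lemma is_cond_exp_ge0 X Y : {ae mu, forall w, 0 <= X w} ->
  is_cond_exp mu G X Y -> {ae mu, forall w, 0 <= Y w}.
Proof.
move=> X0 [iX mY iY eY].
have mYE : measurable_fun [set: Omega] (EFin \o Y) by exact: measurable_int iY.
have mXE : measurable_fun [set: Omega] (EFin \o X) by exact: measurable_int iX.
pose N := [set w | Y w < 0].
have GN : G N.
  have := mY (Y @^-1` [set` `]-oo, 0[]) _; rewrite /N.
  rewrite (_ : Y @^-1` _ = [set w | Y w < 0]); last first.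
    by apply/seteqP; split => w /=; rewrite in_itv.
  by apply; exists [set` `]-oo, 0[]; [exact: measurable_itv|rewrite setTI].
have mN := Gm GN.
have YN : (0 <= \int[mu]_(w in N) (Y w)%:E)%E.
  rewrite eY// (@ae_eq_integral _ _ _ mu N (fun w => `|X w|%:E))//.
  - by apply: integral_ge0 => w _; rewrite lee_fin.
  - exact: measurable_funTS.
  - by apply/measurable_funTS/measurable_EFinP/measurableT_comp => //;
      exact/measurable_EFinP.
  - by apply: filterS X0 => w X0 _; rewrite ger0_norm.
have Yabs : (\int[mu]_(w in N) `|(Y w)%:E| = 0)%E.
  apply/eqP; rewrite eq_le integral_ge0 ?andbT//.
  under eq_integral => w /set_mem Nw do rewrite /= ler0_norm ?(ltW Nw)// EFinN.
  rewrite integralN; last exact: integrable_add_def (integrableS _ _ _ iY).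
  by rewrite oppe_le0.
have := (ae_eq_integral_abs mu mN (measurable_funTS mYE)).1 Yabs.
apply: filterS => w /= YN0; rewrite leNgt; apply/negP => Yw.
by have := YN0 Yw; move=> [] Yw0; rewrite Yw0 ltxx in Yw.
Qed.

End CondExp.

(** * Euclidean norm and coordinates *)

(** The Euclidean norm lies between each coordinate and the sum of all of them;
    L^1 approximation can therefore be checked coordinate by coordinate. *)
Lemma enorm_ge (R : realType) n (x : 'rV[R]_n) i : `|x 0 i| <= enorm x.
Proof.
rewrite -sqrtr_sqr /enorm ler_wsqrtr// (bigD1 i)//= lerDl.
by apply: sumr_ge0 => j _; exact: sqr_ge0.
Qed.

Lemma enorm_le (R : realType) n (x : 'rV[R]_n) : enorm x <= \sum_i `|x 0 i|.
Proof.
have s0 : 0 <= \sum_i `|x 0 i| by exact: sumr_ge0.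
rewrite -(ler_pXn2r (n := 2))// ?nnegrE ?sqrtr_ge0//.
rewrite sqr_sqrtr; last by apply: sumr_ge0 => j _; exact: sqr_ge0.
rewrite expr2 mulr_suml; apply: ler_sum => i _.
rewrite -real_normK ?num_real// expr2 ler_wpM2l// (bigD1 i)//= lerDl.
exact: sumr_ge0.
Qed.

(** * Conditional expectations in the model, P-almost surely *)

Section Model.
Context {R : realType} {disp : measure_display} {Omega : measurableType disp}.
Context {U : topologicalType} {d m k : nat}.
Variable M : model R Omega U d m k.
Hypothesis HM : standing_assumptions M.

Local Notation T := (hor M).
Local Notation P := (ref M).
(* The projection of a random vector, not the coordinates in a basis of a
   vector space. *)
Local Notation coord := Defs.coord.

Lemma Lt_mono t r X : (t <= r)%N -> (r <= T)%N -> Lt M t X -> Lt M r X.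
Proof.
move=> tr rT [mX iX]; split=> //; apply: subset_trans mX _.
exact: (fil_mono HM tr rT).
Qed.

Lemma Q_ae theta (p : Omega -> Prop) : Theta M theta ->
  {ae P, forall w, p w} -> {ae Q M theta, forall w, p w}.
Proof.
move=> Th [N [mN PN Np]]; exists N; split=> //.
have /null_content_dominatesP := Q_dominated HM Th; exact.
Qed.

Lemma ae_Theta (p : 'rV[R]_d -> Omega -> Prop) :
  (forall theta, Theta M theta -> {ae P, forall w, p theta w}) ->
  {ae P, forall w, forall theta, Theta M theta -> p theta w}.
Proof.
have /finite_seqP[s ->] := Theta_finite HM.
elim: s => [_|a s IH H]; first by apply: nearW => w theta; rewrite /= in_nil.
have Ha : {ae P, forall w, p a w} by apply: H; rewrite /= mem_head.
have Hs : {ae P, forall w, forall theta, [set` s] theta -> p theta w}.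
  by apply: IH => theta /= si; apply: H; rewrite /= in_cons si orbT.
apply: filterS2 Ha Hs => w Ha Hs theta /=; rewrite in_cons => /orP[/eqP->//|].
exact: Hs.
Qed.

Section Operator.
Variables (theta : 'rV[R]_d) (t r : nat).
Hypotheses (Th : Theta M theta) (tr : (t <= r)%N) (rT : (r <= T)%N).
Let tT : (t <= T)%N := leq_trans tr rT.
Let sG := fil_sigma HM tT.
Let Gm := fil_sub HM tT.
Implicit Types X Y : Omega -> R.

Lemma Eth_is_cond_exp X : Lt M r X ->
  is_cond_exp (Q M theta) (fil M t) X (Eth M theta t X).
Proof.
move=> LX; have [Y _ cY] := Eth_exists HM Th tr rT LX.
by rewrite /Eth /cond_exp; apply: xgetPex; exists Y.
Qed.

(** The way to obtain P-almost sure identities: a version is characterised only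
    up to Q_theta-null sets, and the standing assumptions make it unique up to
    P-null sets. *)
Lemma Eth_eq X Y : Lt M r X -> is_cond_exp (Q M theta) (fil M t) X Y ->
  {ae P, forall w, Eth M theta t X w = Y w}.
Proof.
by move=> LX cY; exact: (Eth_unique HM Th tr rT LX (Eth_is_cond_exp LX) cY).
Qed.

Lemma Eth_Lt X : Lt M r X -> Lt M t (Eth M theta t X).
Proof.
move=> LX; have [Y LY cY] := Eth_exists HM Th tr rT LX.
have [_ mE _ _] := Eth_is_cond_exp LX.
apply: (L1_ae_eq Gm mE _ LY).
by apply: filterS (Eth_eq LX cY) => w ->.
Qed.

Lemma EthD X Y : Lt M r X -> Lt M r Y ->
  {ae P, forall w, Eth M theta t (fun v => X v + Y v) w =
                   Eth M theta t X w + Eth M theta t Y w}.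
Proof.
move=> LX LY; apply: Eth_eq; first exact: (L1D (fil_sigma HM rT)).
exact: (is_cond_expD sG Gm (Eth_is_cond_exp LX) (Eth_is_cond_exp LY)).
Qed.

(** A version Y of the conditional expectation of X >= 0 is nonnegative only
    Q_theta-almost surely.  But then max(Y, 0) is another version, and P-almost
    sure uniqueness gives Y = max(Y, 0) P-almost surely. *)
Lemma Eth_ge0 X : Lt M r X -> {ae P, forall w, 0 <= X w} ->
  {ae P, forall w, 0 <= Eth M theta t X w}.
Proof.
move=> LX X0; have cX := Eth_is_cond_exp LX.
have Q0 := is_cond_exp_ge0 Gm (Q_ae Th X0) cX.
have [_ mE iE _] := cX.
have L : L1 (Q M theta) (fil M t) (fun w => Num.max (Eth M theta t X w) 0).
  by apply: (L1_max sG Gm); [split|exact: L1_cst].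
have E0 : {ae Q M theta, forall w,
    Eth M theta t X w = Num.max (Eth M theta t X w) 0}.
  by apply: filterS Q0 => w ?; rewrite max_l.
apply: filterS (Eth_eq LX (is_cond_exp_ae_eq Gm L E0 cX)) => w ->.
by rewrite le_max lexx orbT.
Qed.

Lemma Eth_le X Y : Lt M r X -> Lt M r Y -> {ae P, forall w, X w <= Y w} ->
  {ae P, forall w, Eth M theta t X w <= Eth M theta t Y w}.
Proof. exact: (positive_le (fil_sigma HM rT) EthD Eth_ge0). Qed.

Lemma Eth_self X : Lt M t X -> {ae P, forall w, Eth M theta t X w = X w}.
Proof.
move=> LX; have [Y LY [iX _ _ _]] := Eth_exists HM Th (leqnn t) tT LX.
by apply: Eth_eq; [exact: Lt_mono LX|apply: is_cond_exp_self; case: LX].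
Qed.

Lemma Eth_norm X Y : Lt M r X -> Lt M r Y ->
  {ae P, forall w, `|Eth M theta t X w - Eth M theta t Y w| <=
                   Eth M theta t (fun v => `|X v - Y v|) w}.
Proof.
move=> LX LY; have sr := fil_sigma HM rT; have rm := fil_sub HM rT.
have LD : Lt M r (fun v => `|X v - Y v|).
  by apply: (L1_norm sr rm); exact: (L1B sr).
have LXD := L1D sr LX LD; have LYD := L1D sr LY LD.
have XY : {ae P, forall w, X w <= Y w + `|X w - Y w|}.
  by apply: nearW => w; have := ler_norm (X w - Y w); lra.
have YX : {ae P, forall w, Y w <= X w + `|X w - Y w|}.
  by apply: nearW => w; have := ler_norm (Y w - X w); rewrite distrC; lra.
have {}XY := Eth_le LX LYD XY; have {}YX := Eth_le LY LXD YX.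
have aX := EthD LX LD; have aY := EthD LY LD.
apply: filterS2 (filterI XY YX) (filterI aX aY) => w [XYw YXw] [aXw aYw].
by rewrite ler_norml; apply/andP; split; lra.
Qed.

End Operator.

Lemma Eth_tower theta t r X : Theta M theta ->
  (t <= r)%N -> (r <= T)%N -> Lt M T X ->
  {ae P, forall w, Eth M theta t (Eth M theta r X) w = Eth M theta t X w}.
Proof.
move=> Th tr rT LX; have LE := Eth_Lt Th rT (leqnn T) LX.
have c1 := Eth_is_cond_exp Th rT (leqnn T) LX.
have c2 := Eth_is_cond_exp Th tr rT LE.
have := Eth_eq Th (leq_trans tr rT) (leqnn T) LX
  (is_cond_exp_tower (fil_mono HM tr rT) c1 c2).
by apply: filterS => w ->.
Qed.

(** * The worst-case conditional expectation *)

Lemma sup_Eth_Lt t r X : (t <= r)%N -> (r <= T)%N -> Lt M r X ->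
  Lt M t (sup_Eth M t X).
Proof.
move=> tr rT LX; have tT := leq_trans tr rT.
apply: (L1_finite_sup (fil_sigma HM tT) (fil_sub HM tT)
  (Theta_nonempty HM) (Theta_finite HM)) => theta Th.
exact: Eth_Lt LX.
Qed.

(** The supremum over models is not additive, so the automatic continuity is
    applied to the sum over models, which controls it. *)
Lemma sup_Eth_continuous t r e : (t <= r)%N -> (r <= T)%N -> 0 < e ->
  exists2 dl, 0 < dl & forall X Y, Lt M r X -> Lt M r Y ->
    (\int[P]_w `|X w - Y w|%:E < dl%:E)%E ->
    (\int[P]_w `|sup_Eth M t X w - sup_Eth M t Y w|%:E < e%:E)%E.
Proof.
move=> tr rT e0; have tT := leq_trans tr rT.
have sr := fil_sigma HM rT; have rm := fil_sub HM rT.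
have st := fil_sigma HM tT; have tm := fil_sub HM tT.
have /finite_seqP[s Ts] := Theta_finite HM.
have Th theta : theta \in s -> Theta M theta by rewrite Ts.
pose E X w := \sum_(theta <- s) Eth M theta t X w.
have E_L1 X : Lt M r X -> Lt M t (E X).
  by move=> LX; apply: (L1_sum st) => theta si; exact: Eth_Lt (Th _ si) tr rT _ LX.
have E_add X Y : Lt M r X -> Lt M r Y ->
    {ae P, forall w, E (fun v => X v + Y v) w = E X w + E Y w}.
  move=> LX LY.
  have := ae_Theta (fun theta Th => EthD Th tr rT LX LY).
  apply: filterS => w add; rewrite /E -big_split /=.
  by rewrite !big_seq; apply: eq_bigr => theta /Th; exact: add.
have Eth0 X : Lt M r X -> {ae P, forall w, 0 <= X w} ->
    {ae P, forall w, forall theta, Theta M theta -> 0 <= Eth M theta t X w}.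
  by move=> LX X0; apply: ae_Theta => theta Th'; exact: (Eth_ge0 Th' tr rT).
have E_ge0 X : Lt M r X -> {ae P, forall w, 0 <= X w} ->
    {ae P, forall w, 0 <= E X w}.
  move=> LX /(Eth0 _ LX); apply: filterS => w E0.
  by rewrite /E big_seq; apply: sumr_ge0 => theta /Th; exact: E0.
have [dl dl0 Hdl] := positive_continuous sr rm st tm E_L1 E_add E_ge0 e0.
exists dl => // X Y LX LY XY.
have LD : Lt M r (fun w => `|X w - Y w|) by apply/(L1_norm sr rm)/(L1B sr).
have D0 : {ae P, forall w, 0 <= `|X w - Y w|} by apply: nearW.
apply: le_lt_trans (Hdl _ LD (fun=> normr_ge0 _) XY).
apply: (ae_le_integral st tm).
- apply: (L1_norm st tm); apply: (L1B st); exact: sup_Eth_Lt tr rT _.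
- exact: E_L1.
- have H1 := ae_Theta (fun theta Th => Eth_norm Th tr rT LX LY).
  apply: filterS2 H1 (Eth0 _ LD D0) => w H1 H2.
  apply: finite_sup_dist; [exact: Theta_nonempty HM|exact: Theta_finite HM|].
  move=> theta Th'; apply: (le_trans (H1 _ Th')).
  have si : theta \in s by rewrite Ts in Th'.
  rewrite /E (perm_big _ (perm_to_rem si)) big_cons /= lerDl.
  rewrite big_seq; apply: sumr_ge0 => j /mem_rem /Th; exact: H2.
Qed.

(** Translation invariance (cash additivity) of the worst-case expectation with
    respect to what is known at time [t]. *)
Lemma sup_Eth_shift t r X W : (t <= r)%N -> (r <= T)%N ->
  Lt M r X -> Lt M t W ->
  {ae P, forall w, sup_Eth M t (fun v => X v + W v) w = sup_Eth M t X w + W w}.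
Proof.
move=> tr rT LX LW; have LW' := Lt_mono tr rT LW.
have H1 := ae_Theta (fun theta Th => EthD Th tr rT LX LW').
have H2 := ae_Theta (fun theta Th => Eth_self Th tr rT LW).
have A0 := Theta_nonempty HM; have Af := Theta_finite HM.
apply: filterS2 H1 H2 => w H1 H2.
have ub (Z : Omega -> R) theta : Theta M theta ->
    Eth M theta t Z w <= sup_Eth M t Z w.
  exact: (finite_sup_ub Af (fun theta => Eth M theta t Z w)).
apply/eqP; rewrite eq_le; apply/andP; split.
  apply: finite_sup_le => // theta Th.
  by rewrite (H1 _ Th) (H2 _ Th) lerD2r ub.
rewrite -lerBrDr; apply: finite_sup_le => // theta Th.
by rewrite lerBrDr -[W w](H2 _ Th) -(H1 _ Th) ub.
Qed.

(** One half of time consistency, from the tower property and monotonicity: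
    bounding X at a later time by its conditional expectations under every model
    can only increase the worst case; the other half is rectangularity. *)
Lemma sup_Eth_tower_le t r X V : (t <= r)%N -> (r <= T)%N ->
  Lt M T X -> Lt M r V ->
  (forall theta, Theta M theta -> {ae P, forall w, Eth M theta r X w <= V w}) ->
  {ae P, forall w, sup_Eth M t X w <= sup_Eth M t V w}.
Proof.
move=> tr rT LX LV XV.
have H theta : Theta M theta ->
    {ae P, forall w, Eth M theta t X w <= Eth M theta t V w}.
  move=> Th; have LE := Eth_Lt Th rT (leqnn T) LX.
  apply: filterS2 (Eth_tower Th tr rT LX) (Eth_le Th tr rT LE LV (XV _ Th)).
  by move=> w ->.
apply: filterS (ae_Theta H) => w {}H.
apply: finite_sup_le; first exact: Theta_nonempty HM.
move=> theta Th; apply: (le_trans (H _ Th)).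
by apply: (finite_sup_ub (Theta_finite HM) (fun theta => Eth M theta t V w)).
Qed.

(** * Component-wise suprema of random vectors *)

Definition sup_Ethd t (X : Omega -> 'rV[R]_d) : Omega -> 'rV[R]_d :=
  fun w => \row_i sup_Eth M t (coord X i) w.

Implicit Types X Y V W : Omega -> 'rV[R]_d.

Lemma coordD X Y i : coord (fun w => X w + Y w) i = fun w => coord X i w + coord Y i w.
Proof. by apply/funext => w; rewrite /coord mxE. Qed.

Lemma coordB X Y i : coord (fun w => X w - Y w) i = fun w => coord X i w - coord Y i w.
Proof. by apply/funext => w; rewrite /coord !mxE. Qed.

Lemma coord_sup_Ethd t X i : coord (sup_Ethd t X) i = sup_Eth M t (coord X i).
Proof. by apply/funext => w; rewrite /coord mxE. Qed.

Lemma coord_Ethd theta t X i : coord (Ethd M theta t X) i = Eth M theta t (coord X i).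
Proof. by apply/funext => w; rewrite /coord mxE. Qed.

Lemma ae_coord (p : 'I_d -> Omega -> Prop) :
  (forall i, {ae P, forall w, p i w}) -> {ae P, forall w, forall i, p i w}.
Proof. exact: filter_forall. Qed.

Lemma Ltd_mono t r X : (t <= r)%N -> (r <= T)%N -> Ltd M t X -> Ltd M r X.
Proof. by move=> tr rT LX i; exact: (Lt_mono tr rT (LX i)). Qed.

Lemma LtdD t X Y : (t <= T)%N -> Ltd M t X -> Ltd M t Y ->
  Ltd M t (fun w => X w + Y w).
Proof. by move=> tT LX LY i; rewrite coordD; apply: (L1D (fil_sigma HM tT)). Qed.

Lemma sup_Ethd_Ltd t r X : (t <= r)%N -> (r <= T)%N -> Ltd M r X ->
  Ltd M t (sup_Ethd t X).
Proof.
by move=> tr rT LX i; rewrite coord_sup_Ethd; exact: (sup_Eth_Lt tr rT (LX i)).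
Qed.

Lemma le_LtP t X Y : (t <= T)%N -> Ltd M t X -> Ltd M t Y ->
  le_Lt M t X Y <-> forall i, {ae P, forall w, coord X i w <= coord Y i w}.
Proof.
move=> tT LX LY; split=> [[_ +] i|XY].
  by apply: filterS => w /(_ i); rewrite !mxE subr_ge0.
split; first by move=> i; rewrite coordB; apply: (L1B (fil_sigma HM tT)).
by apply: filterS (ae_coord XY) => w H i; rewrite !mxE subr_ge0; exact: H.
Qed.

(** The pointwise maximum is itself an integrable upper bound because Theta is
    finite; a least upper bound is then squeezed between it and itself. *)
Lemma is_vsupP t r X V : (t <= r)%N -> (r <= T)%N -> Ltd M r X ->
  is_vsup M t (fun theta => Ethd M theta t X) V <->
  Ltd M t V /\
  forall i, {ae P, forall w, coord V i w = sup_Eth M t (coord X i) w}.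
Proof.
move=> tr rT LX; have tT := leq_trans tr rT.
have A0 := Theta_nonempty HM; have Af := Theta_finite HM.
have LE theta : Theta M theta -> Ltd M t (Ethd M theta t X).
  by move=> Th i; rewrite coord_Ethd; exact: (Eth_Lt Th tr rT (LX i)).
have LS := sup_Ethd_Ltd tr rT LX.
have ub theta i w : Theta M theta ->
    Eth M theta t (coord X i) w <= sup_Eth M t (coord X i) w.
  exact: (finite_sup_ub Af (fun theta => Eth M theta t (coord X i) w)).
have le_sup V' i : (forall theta, Theta M theta ->
      {ae P, forall w, Eth M theta t (coord X i) w <= coord V' i w}) ->
    {ae P, forall w, sup_Eth M t (coord X i) w <= coord V' i w}.
  by move=> /ae_Theta; apply: filterS => w H; exact: finite_sup_le.
have geV V' : Ltd M t V' ->
    (forall theta, Theta M theta -> le_Lt M t (Ethd M theta t X) V') ->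
    forall i, {ae P, forall w, sup_Eth M t (coord X i) w <= coord V' i w}.
  move=> LV' H i; apply: le_sup => theta Th.
  have /(le_LtP tT (LE _ Th) LV')/(_ i) := H _ Th.
  by rewrite coord_Ethd.
split=> [[LV Vub Vleast]|[LV VE]].
  split=> // i; have leV := geV _ LV Vub i.
  have /(le_LtP tT LV LS)/(_ i) : le_Lt M t V (sup_Ethd t X).
    apply: Vleast => // theta Th; apply/(le_LtP tT (LE _ Th) LS) => i'.
    by rewrite coord_Ethd coord_sup_Ethd; apply: nearW => w; exact: ub.
  rewrite coord_sup_Ethd => Vle; apply: filterS2 Vle leV => w ? ?.
  by apply/eqP; rewrite eq_le; apply/andP.
split=> // [theta Th|A LA Aub].
  apply/(le_LtP tT (LE _ Th) LV) => i; rewrite coord_Ethd.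
  by apply: filterS (VE i) => w ->; exact: ub.
apply/(le_LtP tT LV LA) => i.
by apply: filterS2 (VE i) (geV _ LA Aub i) => w ->.
Qed.

Lemma sup_Ethd_vsup t r X : (t <= r)%N -> (r <= T)%N -> Ltd M r X ->
  is_vsup M t (fun theta => Ethd M theta t X) (sup_Ethd t X).
Proof.
move=> tr rT LX; apply/(is_vsupP _ tr rT LX); split; first exact: (sup_Ethd_Ltd tr rT LX).
by move=> i; rewrite coord_sup_Ethd; apply: nearW.
Qed.

(** * Closures in L^1 *)

Lemma enorm_measurable t X : (t <= T)%N -> Ltd M t X ->
  measurable_fun [set: Omega] (fun w => enorm (X w)).
Proof.
move=> tT LX; apply: (@measurableT_comp _ _ _ _ _ _ (@Num.sqrt R)).
  by apply: continuous_measurable_fun; exact: sqrt_continuous.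
apply: measurable_sum => i; apply: measurable_funX.
by apply: (G_measurable_fun (fil_sub HM tT)); case: (LX i).
Qed.

Lemma closure_L1P t B X : (t <= T)%N -> closure_L1 M t B X <->
  Ltd M t X /\ forall e : R, 0 < e -> exists2 Y, B Y /\ Ltd M t Y &
    forall i, (\int[P]_w `|coord X i w - coord Y i w|%:E < e%:E)%E.
Proof.
move=> tT; have st := fil_sigma HM tT; have tm := fil_sub HM tT.
have mD Y Z i : Ltd M t Y -> Ltd M t Z ->
    measurable_fun [set: Omega] (fun w => `|coord Y i w - coord Z i w|%:E).
  move=> LY LZ; apply: (L1_measurable tm (mu := P)).
  exact/(L1_norm st tm)/(L1B st).
have mE Y Z : Ltd M t Y -> Ltd M t Z ->
    measurable_fun [set: Omega] (fun w => (enorm (Y w - Z w))%:E).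
  move=> LY LZ; apply/measurable_EFinP/(enorm_measurable tT) => i.
  by rewrite coordB; exact: (L1B st).
split=> -[LX cX]; split=> // e e0.
  have [Y [BY LY] XY] := cX _ e0; exists Y => // i; apply: le_lt_trans XY.
  apply: ge0_le_integral => //; [exact: mD|exact: mE|].
  by move=> w _; rewrite lee_fin; have := enorm_ge (X w - Y w) i; rewrite !mxE.
(* [d.+1] rather than [d], as [d] may be 0. *)
have e0' : 0 < e / d.+1%:R by rewrite divr_gt0.
have [Y [BY LY] XY] := cX _ e0'; exists Y => //.
apply: (@le_lt_trans _ _ (\int[P]_w \sum_i `|coord X i w - coord Y i w|%:E)%E).
  apply: ge0_le_integral => //; [by move=> w _; rewrite lee_fin sqrtr_ge0|exact: mE| |].
    by apply: emeasurable_sum => i; exact: mD.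
  move=> w _; rewrite sumEFin lee_fin; apply: (le_trans (enorm_le _)).
  by apply: ler_sum => i _; rewrite !mxE.
rewrite ge0_integral_sum//; last by move=> i; exact: mD.
apply: (@le_lt_trans _ _ (\sum_(i < d) (e / d.+1%:R)%:E)%E).
  by apply: lee_sum => i _; exact/ltW/XY.
rewrite sumEFin lte_fin sumr_const card_ord -[ltLHS]mulr_natr -mulrA.
rewrite gtr_pMr// mulrC ltr_pdivrMr// mul1r ltr_nat//.
Qed.

Lemma closure_L1_sub t B : (t <= T)%N -> B `<=` Ltd M t -> B `<=` closure_L1 M t B.
Proof.
move=> tT BL X BX; apply/closure_L1P => //; split; first exact: BL.
move=> e e0; exists X; first by split=> //; exact: BL.
move=> i; under eq_integral do rewrite subrr normr0.
by rewrite integral0.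
Qed.

(** Closures are closed, in the form needed to pass inclusions to closures. *)
Lemma closure_L1_closed t B C : (t <= T)%N -> B `<=` closure_L1 M t C ->
  closure_L1 M t B `<=` closure_L1 M t C.
Proof.
move=> tT BC X /(closure_L1P _ _ tT)[LX cX]; apply/closure_L1P => //; split=> // e e0.
have st := fil_sigma HM tT; have tm := fil_sub HM tT.
have e20 : 0 < e / 2 by rewrite divr_gt0.
have [Y [BY LY] XY] := cX _ e20.
have /(closure_L1P _ _ tT)[_ cY] := BC _ BY.
have [Z [CZ LZ] YZ] := cY _ e20.
exists Z => // i.
have LN V W : Ltd M t V -> Ltd M t W ->
    Lt M t (fun w => `|coord V i w - coord W i w|).
  by move=> LV LW; exact/(L1_norm st tm)/(L1B st).
apply: (@le_lt_trans _ _ (\int[P]_w (`|coord X i w - coord Y i w|%:E +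
                                     `|coord Y i w - coord Z i w|%:E))%E).
  apply: (ae_le_integral st tm (LN _ _ LX LZ) (L1D st (LN _ _ LX LY) (LN _ _ LY LZ))).
  by apply: nearW => w; exact: ler_distD.
rewrite (integralD measurableT (L1_integrable (LN _ _ LX LY))
                               (L1_integrable (LN _ _ LY LZ))).
by rewrite [e]splitr EFinD; apply: lteD; [exact: XY|exact: YZ].
Qed.

(** * Dynamic programming *)

Lemma sup_Ethd_value t S phi : (t < T)%N -> state M t S -> adm M t S phi ->
  value M t S (sup_Ethd t (terminal_loss M t S phi)).
Proof.
move=> tT St Aphi; rewrite /value tT; exists phi => //.
exact: (sup_Ethd_vsup (ltnW tT) (leqnn T) (loss_integrable HM (ltnW tT) St Aphi)).
Qed.

(** Treats uniformly the times before the horizon, where the bounds come from the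
    supremum, and the horizon itself, where the conditional expectation of the
    loss is the loss. *)
Lemma value_bounds t S V : (t <= T)%N -> state M t S -> value M t S V ->
  exists phi, [/\ adm M t S phi, Ltd M t V & forall i theta, Theta M theta ->
    {ae P, forall w,
       Eth M theta t (coord (terminal_loss M t S phi) i) w <= coord V i w}].
Proof.
move=> tT St; rewrite /value; case: ltnP => [tT'|Tt].
  move=> [phi Aphi HV]; exists phi.
  have Ll := loss_integrable HM tT St Aphi.
  have [LV Vub _] := HV; split=> // i theta Th.
  have LE : Ltd M t (Ethd M theta t (terminal_loss M t S phi)).
    by move=> j; rewrite coord_Ethd; exact: (Eth_Lt Th tT (leqnn T) (Ll j)).
  by have /(le_LtP tT LE LV)/(_ i) := Vub _ Th; rewrite coord_Ethd.
have tE : t = T by apply/eqP; rewrite eqn_leq tT.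
move: St; rewrite tE => St [LV Vl]; exists [::]; split=> // i theta Th.
have Ll := @loss_integrable _ _ _ _ _ _ _ _ HM T S [::] (leqnn T) St erefl.
apply: filterS2 (Eth_self Th (leqnn T) (leqnn T) (Ll i)) Vl => w -> Vl.
by rewrite /coord Vl.
Qed.

(** A bound V of a worst-case expected loss L is L plus the nonnegative V - L. *)
Lemma value_pos_of_ge t S phi V : (t < T)%N -> state M t S -> adm M t S phi ->
  Ltd M t V ->
  (forall i, {ae P, forall w,
     sup_Eth M t (coord (terminal_loss M t S phi) i) w <= coord V i w}) ->
  [set (fun w => V w + W w) | V in value M t S & W in Ltd_pos M t] V.
Proof.
move=> tT St Aphi LV Vge; have tT' := ltnW tT.
have Ll := loss_integrable HM tT' St Aphi.
set L := terminal_loss M t S phi in Vge Ll.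
have LS := sup_Ethd_Ltd tT' (leqnn T) Ll.
exists (sup_Ethd t L); first exact: sup_Ethd_value.
exists (fun w => V w - sup_Ethd t L w).
  apply: (le_LtP tT' LS LV).2 => i; rewrite coord_sup_Ethd; exact: Vge.
by apply/funext => w; rewrite addrC subrK.
Qed.

Lemma Ltd_value t S V : (t <= T)%N -> value M t S V -> Ltd M t V.
Proof.
move=> tT; rewrite /value; case: ltnP => [_ [phi _ []]//|Tt [LV _]].
by have -> : t = T by apply/eqP; rewrite eqn_leq tT.
Qed.

Lemma Ltd_value_pos t S : (t <= T)%N ->
  [set (fun w => V w + W w) | V in value M t S & W in Ltd_pos M t] `<=` Ltd M t.
Proof.
move=> tT _ [V VV [W [LW _] <-]].
by apply: (LtdD tT) => //; exact: Ltd_value VV.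
Qed.

Theorem one_step_sub_upper_image t S : (t < T)%N -> state M t S ->
  one_step M t S `<=` upper_image M t S.
Proof.
move=> tT St V [c [X [Ac PX VX]]]; have tT' := ltnW tT.
have St1 := state_next HM tT St Ac.
have /(closure_L1P _ _ tT)[LX cX] := PX.
have /(is_vsupP _ (leqnSn t) tT LX)[LV VE] := VX.
apply/(closure_L1P _ _ tT'); split=> // e e0.
have [dl dl0 Hdl] := sup_Eth_continuous (leqnSn t) tT e0.
have [Y [[V' VV' [W [LW W0] YE]] LY] XY] := cX _ dl0.
have [phi [Aphi LV' phiV']] := value_bounds tT St1 VV'.
have LSY := sup_Ethd_Ltd (leqnSn t) tT LY.
have Aphi' : adm M t S (c :: phi) by [].
exists (sup_Ethd t Y).
  split=> //; apply: (value_pos_of_ge tT St Aphi') => // i.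
  have Ll := loss_integrable HM tT' St Aphi'.
  rewrite coord_sup_Ethd.
  apply: (sup_Eth_tower_le (leqnSn t) tT (Ll i) (LY i)) => theta Th.
  apply: filterS2 (phiV' i theta Th) W0 => w lV' W0.
  by apply: (le_trans lV'); rewrite -YE coordD lerDl; exact: W0.
move=> i; apply: le_lt_trans (Hdl _ _ (LX i) (LY i) (XY i)).
have st := fil_sigma HM tT'; have tm := fil_sub HM tT'.
have LSX : Lt M t (sup_Eth M t (coord X i)) by exact: (sup_Eth_Lt (leqnSn t) tT (LX i)).
have LSYi : Lt M t (sup_Eth M t (coord Y i)) by exact: (sup_Eth_Lt (leqnSn t) tT (LY i)).
rewrite coord_sup_Ethd; apply: (ae_le_integral st tm).
- exact/(L1_norm st tm)/(L1B st).
- exact/(L1_norm st tm)/(L1B st).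
- by apply: filterS (VE i) => w ->.
Qed.

(** Before time T - 1 the witness is the worst-case expectation at time t + 1 and
    the identity is rectangularity.  At time T - 1 the value set at t + 1
    consists of the terminal loss itself. *)
Lemma continuation_value t S c phi : m_rectangular M ->
  (t < T)%N -> state M t S -> adm M t S (c :: phi) ->
  exists2 V, value M t.+1 (next_state M t S c) V & forall i,
    {ae P, forall w, sup_Eth M t (coord V i) w =
                     sup_Eth M t (coord (terminal_loss M t S (c :: phi)) i) w}.
Proof.
move=> rect tT St Aphi; have [_ Ac Aphi1] := Aphi.
have Ll := loss_integrable HM (ltnW tT) St Aphi.
have St1 := state_next HM tT St Ac.
have [tT1|Tt1] := ltnP t.+1 T.
  exists (sup_Ethd t.+1 (terminal_loss M t S (c :: phi))).
    exact: (sup_Ethd_value tT1 St1 Aphi1).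
  by move=> i; rewrite coord_sup_Ethd; exact: (rect _ _ tT (Ll i)).
exists (terminal_loss M t S (c :: phi)); last by move=> i; apply: nearW.
have phi0 : phi = [::].
  by case: phi Aphi1 {Aphi Ll} => // c' phi [tT1]; rewrite ltnNge Tt1 in tT1.
rewrite /value ltnNge Tt1 /=; split=> //; apply: nearW => w.
by rewrite phi0.
Qed.

Theorem value_pos_sub_one_step t S : m_rectangular M ->
  (t < T)%N -> state M t S ->
  [set (fun w => V w + W w) | V in value M t S & W in Ltd_pos M t] `<=`
  one_step M t S.
Proof.
move=> rect tT St _ [V VV [W WW <-]]; have tT' := ltnW tT.
have := VV; rewrite /value tT => -[phi Aphi HV].
case: phi => [|c phi] in Aphi HV *; first by rewrite /= in Aphi; rewrite Aphi ltnn in tT.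
have Ll := loss_integrable HM tT' St Aphi.
have [LV VE] := (is_vsupP _ tT' (leqnn T) Ll).1 HV.
have [V' VV' V'E] := continuation_value rect tT St Aphi.
have [_ Ac _] := Aphi; have [LW W0] := WW.
have LV' := Ltd_value tT VV'; have LW' := Ltd_mono (leqnSn t) tT LW.
have LX := LtdD tT LV' LW'.
exists c, (fun w => V' w + W w); split=> //.
  apply: (closure_L1_sub tT (Ltd_value_pos tT)).
  by exists V' => //; exists W.
apply/(is_vsupP _ (leqnSn t) tT LX); split; first exact: (LtdD tT').
move=> i; rewrite !coordD.
apply: filterS2 (filterI (VE i) (V'E i)) (sup_Eth_shift (leqnSn t) tT (LV' i) (LW i)).
by move=> w [Vw V'w] ->; rewrite Vw V'w.
Qed.

End Model.

Theorem proposition4p7 (R : realType) (disp : measure_display)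
    (Omega : measurableType disp) (U : topologicalType) (d m k : nat)
    (M : model R Omega U d m k) (HM : standing_assumptions M) :
  (forall (t : nat) (S : Omega -> 'rV[R]_m), (t < hor M)%N -> state M t S ->
     one_step M t S `<=` upper_image M t S) /\
  (m_rectangular M ->
   forall (t : nat) (S : Omega -> 'rV[R]_m), (t < hor M)%N -> state M t S ->
     upper_image M t S = closure_L1 M t (one_step M t S)).
Proof.
have part1 := one_step_sub_upper_image HM.
split=> // rect t S tT St; have tT' := ltnW tT.
apply/seteqP; split.
  apply: (closure_L1_closed HM tT').
  apply: subset_trans (value_pos_sub_one_step HM rect tT St) _.
  by apply: (closure_L1_sub HM tT') => V [c [X [_ _ []]]].
apply: (closure_L1_closed HM tT'); exact: part1.
Qed.
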